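(* Let $M_\upsilon\in\mathbb{R}^{n\times n}$ be symmetric positive definite, let $\Phi=[\Phi_1,\dots,\Phi_n]\in\mathbb{R}^{n\times n}$ have columns forming an $M_\upsilon$-orthonormal basis of $\mathbb{R}^n$ (i.e. $\Phi^{\top}M_\upsilon\Phi=I_n$), let $1\le r\le n$, $\Phi_r=[\Phi_1,\dots,\Phi_r]\in\mathbb{R}^{n\times r}$, $\Phi_r^{*}=\Phi_r^{\top}M_\upsilon\in\mathbb{R}^{r\times n}$ and $\widehat{\mathcal S}_\upsilon=\operatorname{span}\{\Phi_1,\dots,\Phi_r\}$. Let $\chi$ be an $\mathbb{R}^n$-valued random variable with finite second moments, and let the control variate be $\hat\upsilon=\Phi_r^{*}\chi$, with $\Sigma_{\hat\upsilon,\hat\upsilon}$ invertible. Then: (1) $\chi=\Phi_r\Phi_r^{*}\chi+(I-\Phi_r\Phi_r^{*})\chi=\Phi_r\hat\upsilon+\Delta\chi_r$, where $\Delta\chi_r:=(I-\Phi_r\Phi_r^{*})\chi$. (2) The optimal gain $S^{\mathrm{opt}}=\Sigma_{\chi,\hat\upsilon}\,\Sigma_{\hat\upsilon,\hat\upsilon}^{-1}$ for the total variate $\zeta=\chi-S(\hat\upsilon-\mu_{\hat\upsilon})$ equals $$S^{\mathrm{opt}}=\Phi_r+\Sigma_{\Delta\chi_r,\hat\upsilon}\,\Sigma_{\hat\upsilon,\hat\upsilon}^{-1}.$$ (3) Using the approximate gain $S=\Phi_r$, the total variate $\zeta=\chi-\Phi_r(\hat\upsilon-\mu_{\hat\upsilon})$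 has no variability within $\widehat{\mathcal S}_\upsilon$; that is, the $M_\upsilon$-orthogonal projection $\Phi_r\Phi_r^{*}\zeta$ of $\zeta$ onto $\widehat{\mathcal S}_\upsilon$ is deterministic (has zero covariance).
   Context: For random vectors $\chi,\upsilon$: $\mu_\chi=\mathbb{E}[\chi]$ and $\Sigma_{\chi,\upsilon}=\mathbb{E}[(\chi-\mu_\chi)(\upsilon-\mu_\upsilon)^{\top}]$. In the linear control variate framework, $\chi$ (values in $\mathbb{R}^n$) is the principal variate, $\hat\upsilon$ (values in $\mathbb{R}^r$) is the control variate, and for a deterministic gain matrix $S\in\mathbb{R}^{n\times r}$ the total variate is $\zeta=\chi-S(\hat\upsilon-\mu_{\hat\upsilon})$. The optimal gain is the matrix $\Sigma_{\chi,\hat\upsilon}\Sigma_{\hat\upsilon,\hat\upsilon}^{-1}$, which minimizes the determinant of $\Sigma_{\zeta,\zeta}$ over $S$. The $M_\upsilon$ inner product on $\mathbb{R}^n$ is $\langle x,y\rangle_{M_\upsilon}=x^{\top}M_\upsilon y$. *)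

(* Defs.v *)
From HB Require Import structures.
From mathcomp Require Import all_boot all_order all_algebra.
From mathcomp Require Import all_classical all_reals all_analysis.

Set Implicit Arguments.
Unset Strict Implicit.
Unset Printing Implicit Defensive.

Import Order.TTheory GRing.Theory Num.Theory.

Local Open Scope ring_scope.

Definition mx_inner (R : realType) (n : nat) (M : 'M[R]_n) (x y : 'cV[R]_n) : R :=
  (x^T *m M *m y) 0 0.

Definition posdef_mx (R : realType) (n : nat) (M : 'M[R]_n) : Prop :=
  M^T = M /\ forall x : 'cV[R]_n, x != 0 -> 0 < mx_inner M x x.

Definition first_cols (R : realType) (n r : nat) (hrn : (r <= n)%N)
    (Phi : 'M[R]_n) : 'M[R]_(n, r) :=
  colsub (widen_ord hrn) Phi.

Definition col_span (R : realType) (n r : nat) (A : 'M[R]_(n, r)) :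
    {vspace 'cV[R]_n} :=
  <<[seq col j A | j : 'I_r]>>%VS.

Definition is_orth_proj (R : realType) (n : nat) (M : 'M[R]_n)
    (U : {vspace 'cV[R]_n}) (x p : 'cV[R]_n) : Prop :=
  p \in U /\ forall y : 'cV[R]_n, y \in U -> mx_inner M (x - p) y = 0.

(* Random vectors are functions T -> 'cV[R]_n on a probability space (T, P).
   Expectations are taken entrywise; [fine] sends an infinite expectation to 0,
   so the definitions below are meaningful for vectors with finite second
   moments. *)

(* Membership in Lfun includes measurability of each coordinate. *)
Definition finite_second_moments d (T : measurableType d) (R : realType)
    (P : probability T R) (n : nat) (X : T -> 'cV[R]_n) : Prop :=
  forall i : 'I_n, (fun w => X w i 0) \in Lfun P 2%:E.

Definition mean_mx d (T : measurableType d) (R : realType)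
    (P : probability T R) (m n : nat) (X : T -> 'M[R]_(m, n)) : 'M[R]_(m, n) :=
  \matrix_(i, j) fine ('E_P[fun w => X w i j])%E.

Definition cov_mx d (T : measurableType d) (R : realType)
    (P : probability T R) (m n : nat)
    (X : T -> 'cV[R]_m) (Y : T -> 'cV[R]_n) : 'M[R]_(m, n) :=
  mean_mx P (fun w => (X w - mean_mx P X) *m (Y w - mean_mx P Y)^T).

Lemma cov_mxE d (T : measurableType d) (R : realType)
    (P : probability T R) (m n : nat)
    (X : T -> 'cV[R]_m) (Y : T -> 'cV[R]_n) (i : 'I_m) (j : 'I_n) :
  cov_mx P X Y i j
  = fine (covariance P (fun w => X w i 0) (fun w => Y w j 0)).
Proof.
rewrite mxE covariance.unlock; congr (fine (expectation P _)); apply/funext => w.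
by rewrite !mxE big_ord1 !mxE.
Qed.

(* X is the principal variate, Y the control variate and S the gain. *)
Definition total_variate d (T : measurableType d) (R : realType)
    (P : probability T R) (n r : nat) (S : 'M[R]_(n, r))
    (X : T -> 'cV[R]_n) (Y : T -> 'cV[R]_r) : T -> 'cV[R]_n :=
  fun w => X w - S *m (Y w - mean_mx P Y).

Definition optimal_gain d (T : measurableType d) (R : realType)
    (P : probability T R) (n r : nat)
    (X : T -> 'cV[R]_n) (Y : T -> 'cV[R]_r) : 'M[R]_(n, r) :=
  cov_mx P X Y *m invmx (cov_mx P Y Y).

(* Main.v *)
(* The M-orthonormality of Phi restricts to Phi_r^* Phi_r = 1, so Phi_r Phi_r^* is
   the M-orthogonal projection onto the span and Phi_r Phi_r^* zeta reduces
   pointwise to the constant Phi_r mu.  The gain formula is left linearity of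
   the covariance applied to chi = Phi_r ups_hat + Dchi_r. *)
Require Import Defs.
From mathcomp Require Import all_boot all_order all_algebra.
From mathcomp Require Import all_classical all_reals all_analysis.

Set Implicit Arguments.
Unset Strict Implicit.
Unset Printing Implicit Defensive.

Local Open Scope ring_scope.

Import GRing.Theory Num.Theory.

Section Covariance.
Context d (T : measurableType d) (R : realType) (P : probability T R).

Let Lfun2_1 (X : T -> R) : X \in Lfun P 2%:E -> X \in Lfun P 1.
Proof. by apply/Lfun_subset12; exact: fin_num_measure. Qed.

Lemma Lfun2_sum I (s : seq I) (F : I -> T -> R) :
  (forall i, F i \in Lfun P 2%:E) -> \sum_(i <- s) F i \in Lfun P 2%:E.
Proof.
move=> F2; elim/big_rec: _ => [|i X _ X2]; first by rewrite rpred0// lee1n.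
by rewrite rpredD// lee1n.
Qed.

Lemma covariance_suml I (s : seq I) (F : I -> T -> R) (Y : T -> R) :
  (forall i, F i \in Lfun P 2%:E) -> Y \in Lfun P 2%:E ->
  covariance P (\sum_(i <- s) F i) Y = (\sum_(i <- s) covariance P (F i) Y)%E.
Proof.
move=> F2 Y2; elim: s => [|i s IH].
  (* The empty sum of functions is restated as [cst 0], whose covariance vanishes. *)
  by rewrite !big_nil [X in covariance P X _](_ : _ = cst 0) ?covariance_cst_l.
by rewrite !big_cons -IH -covarianceDl//; exact: Lfun2_sum.
Qed.

(** Both factors are integrable because [P] has finite mass, and the product of two
    square-integrable functions is integrable. *)
Lemma covariance_fin_num2 (X Y : T -> R) :
  X \in Lfun P 2%:E -> Y \in Lfun P 2%:E -> covariance P X Y \is a fin_num.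
Proof.
move=> X2 Y2; apply: covariance_fin_num; [exact: Lfun2_1 | exact: Lfun2_1 |].
exact: Lfun2_mul_Lfun1.
Qed.

(** Puts a coordinate of [A *m X] into the shape of a sum of scaled functions, on which the
    linearity rules for [Lfun] and [covariance] act. *)
Lemma mulmx_coordE m n (A : 'M[R]_(m, n)) (X : T -> 'cV[R]_n) i :
  (fun w => (A *m X w) i 0) = \sum_j (A i j \o* (fun w => X w j 0)).
Proof.
apply/funext => w; rewrite mxE fct_sumE.
by apply: eq_bigr => j _; rewrite /= mulrC.
Qed.

Lemma finite_second_moments_mulmx m n (A : 'M[R]_(m, n)) (X : T -> 'cV[R]_n) :
  finite_second_moments P X -> finite_second_moments P (fun w => A *m X w).
Proof.
move=> X2 i; rewrite mulmx_coordE; apply: Lfun2_sum => j.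
by apply: Lfun_scale; [rewrite ler1n | exact: X2].
Qed.

Lemma cov_mx_mull m n p (A : 'M[R]_(m, n)) (X : T -> 'cV[R]_n)
    (Y : T -> 'cV[R]_p) :
  finite_second_moments P X -> finite_second_moments P Y ->
  cov_mx P (fun w => A *m X w) Y = A *m cov_mx P X Y.
Proof.
move=> X2 Y2; apply/matrixP => i k.
have AX2 j : A i j \o* (fun w => X w j 0) \in Lfun P 2%:E.
  by apply: Lfun_scale; [rewrite ler1n | exact: X2].
(* [fine] commutes with a sum only when the terms are finite; finite second moments guarantee
   this. *)
rewrite cov_mxE mulmx_coordE covariance_suml// mxE -sum_fine; last first.
  by move=> j _; exact: covariance_fin_num2.
apply: eq_bigr => j _; rewrite cov_mxE covarianceZl.
- by rewrite fineM//; exact: covariance_fin_num2.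
- exact/Lfun2_1/X2.
- exact/Lfun2_1/Y2.
- exact: Lfun2_mul_Lfun1.
Qed.

Lemma cov_mxDl m p (X Y : T -> 'cV[R]_m) (Z : T -> 'cV[R]_p) :
  finite_second_moments P X -> finite_second_moments P Y ->
  finite_second_moments P Z ->
  cov_mx P (fun w => X w + Y w) Z = cov_mx P X Z + cov_mx P Y Z.
Proof.
move=> X2 Y2 Z2; apply/matrixP => i k; rewrite [RHS]mxE !cov_mxE.
rewrite [X in covariance P X _](_ : _ =
  (fun w => X w i 0) \+ (fun w => Y w i 0)); last first.
  by apply/funext => w; rewrite mxE.
by rewrite covarianceDl// fineD//; exact: covariance_fin_num2.
Qed.

Lemma cov_mx_cst_l m p (c : 'cV[R]_m) (Y : T -> 'cV[R]_p) :
  cov_mx P (cst c) Y = 0.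
Proof. by apply/matrixP => i k; rewrite cov_mxE covariance_cst_l mxE. Qed.

End Covariance.

Section OrthogonalProjection.
Context (R : realType) (n r : nat).

Lemma mulmx_col_span (A : 'M[R]_(n, r)) (v : 'cV[R]_r) : A *m v \in col_span A.
Proof.
have -> : A *m v = \sum_j v j 0 *: col j A.
  apply/matrixP => i k; rewrite mxE summxE ord1; apply: eq_bigr => j _.
  by rewrite !mxE mulrC.
apply: rpred_sum => j _; apply/rpredZ/memv_span/map_f; exact: mem_enum.
Qed.

(** Vectors of the form [A *m v] include zero and all multiples of columns and are closed under
    addition, so they include every combination given by [coord_span]. *)
Lemma col_spanP (A : 'M[R]_(n, r)) (y : 'cV[R]_n) :
  y \in col_span A -> exists v : 'cV[R]_r, y = A *m v.
Proof.
move=> /(@coord_span _ _ _ (in_tuple _)) ->; elim/big_ind: _.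
- by exists 0; rewrite mulmx0.
- by move=> _ _ [u ->] [v ->]; exists (u + v); rewrite mulmxDr.
- move=> i _; set a := coord _ _ _.
  have /mapP[j _ ->] : (in_tuple [seq col j A | j : 'I_r])`_i
      \in [seq col j A | j : 'I_r].
    exact/mem_nth/ltn_ord.
  (* Column [j] is [A] applied to the [j]-th standard basis vector. *)
  by exists (a *: delta_mx j 0); rewrite -scalemxAr colE.
Qed.

(** With [M] symmetric, the transposed residual times [M *m A] is [x^T *m M *m A - x^T *m M *m A *m
    (A^T *m M *m A)], and the last factor is the identity. *)
Lemma is_orth_proj_mulmx (M : 'M[R]_n) (A : 'M[R]_(n, r)) (x : 'cV[R]_n) :
  M^T = M -> A^T *m M *m A = 1%:M ->
  is_orth_proj M (col_span A) x (A *m (A^T *m M) *m x).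
Proof.
move=> Msym AMA; split; first by rewrite -mulmxA mulmx_col_span.
move=> _ /col_spanP[v ->]; rewrite /mx_inner.
suff -> : (x - A *m (A^T *m M) *m x)^T *m M *m (A *m v) = 0 by rewrite mxE.
rewrite linearB /= !trmx_mul trmxK Msym !mulmxBl -!mulmxA.
by rewrite (mulmxA A^T) (mulmxA (A^T *m M)) AMA mul1mx subrr.
Qed.

(** The Gram matrix of the first [r] columns is the leading block of that of [Phi]. *)
Lemma first_cols_orthonormal (hrn : (r <= n)%N) (M Phi : 'M[R]_n) :
  Phi^T *m M *m Phi = 1%:M ->
  (first_cols hrn Phi)^T *m M *m first_cols hrn Phi = 1%:M.
Proof.
move=> /matrixP PhiMPhi; apply/matrixP => i j.
have := PhiMPhi (widen_ord hrn i) (widen_ord hrn j).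
(* Ordinals are compared through their values, which [widen_ord] preserves, so the two Kronecker
   deltas are convertible. *)
rewrite !mxE => PhiE; rewrite -[RHS]PhiE; apply: eq_bigr => k _.
by rewrite !mxE; congr (_ * _); apply: eq_bigr => l _; rewrite !mxE.
Qed.

End OrthogonalProjection.

Theorem theorem3p1 (R : realType) (d : measure_display) (T : measurableType d)
    (P : probability T R) (n r : nat) (hr : (1 <= r)%N) (hrn : (r <= n)%N)
    (M Phi : 'M[R]_n) (chi : T -> 'cV[R]_n)
    (hM : posdef_mx M)
    (hPhi : Phi^T *m M *m Phi = 1%:M)
    (hchi : finite_second_moments P chi) :
  let Phi_r := first_cols hrn Phi in
  let Phi_rs := Phi_r^T *m M in
  let S_hat := col_span Phi_r in
  let ups_hat := fun w : T => Phi_rs *m chi w in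
  let Dchi_r := fun w : T => (1%:M - Phi_r *m Phi_rs) *m chi w in
  cov_mx P ups_hat ups_hat \in unitmx ->
  [/\ (forall w : T,
         chi w = Phi_r *m Phi_rs *m chi w + (1%:M - Phi_r *m Phi_rs) *m chi w
         /\ chi w = Phi_r *m ups_hat w + Dchi_r w),
      optimal_gain P chi ups_hat
        = Phi_r + cov_mx P Dchi_r ups_hat *m invmx (cov_mx P ups_hat ups_hat)
    & let zeta := total_variate P Phi_r chi ups_hat in
      let proj_zeta := fun w : T => Phi_r *m Phi_rs *m zeta w in
      [/\ (forall w : T, is_orth_proj M S_hat (zeta w) (proj_zeta w)),
          (exists c : 'cV[R]_n, forall w : T, proj_zeta w = c)
        & cov_mx P proj_zeta proj_zeta = 0]].
Proof.
move=> Phi_r Phi_rs S_hat ups_hat Dchi_r cov_unit.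
have PhirK : Phi_rs *m Phi_r = 1%:M by exact: first_cols_orthonormal.
have chiE w : chi w = Phi_r *m ups_hat w + Dchi_r w.
  by rewrite /ups_hat /Dchi_r mulmxBl mul1mx mulmxA addrC subrK.
have ups2 : finite_second_moments P ups_hat.
  exact: finite_second_moments_mulmx.
split=> [w||zeta proj_zeta].
- by split=> //; rewrite mulmxBl mul1mx addrC subrK.
- rewrite /optimal_gain.
  rewrite [X in cov_mx P X _](_ : _ = fun w => Phi_r *m ups_hat w + Dchi_r w);
    last exact/funext.
  rewrite cov_mxDl//; [|exact: finite_second_moments_mulmx..].
  (* Invertibility of the covariance of [ups_hat] cancels it against its inverse, leaving [Phi_r]
     alone. *)
  by rewrite cov_mx_mull// mulmxDl mulmxK.
- have projE w : proj_zeta w = Phi_r *m mean_mx P ups_hat.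
    rewrite /proj_zeta /zeta /total_variate -mulmxA; congr (_ *m _).
    (* Applying [Phi_rs] to [zeta w] gives [ups_hat w - (ups_hat w - mean_mx P ups_hat)], so the
       random part cancels. *)
    by rewrite mulmxBr mulmxA PhirK mul1mx subKr.
  split=> [w||]; first by apply: is_orth_proj_mulmx => //; exact: hM.1.
  + by exists (Phi_r *m mean_mx P ups_hat).
  + by rewrite (_ : proj_zeta = cst (Phi_r *m mean_mx P ups_hat))
      ?cov_mx_cst_l//; exact/funext.
Qed.
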